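(* Let $\Bbbk\supseteq\mathbb{Q}$ be a local domain, $x$ a single variable, and $R:=D^{alg}(\Bbbk[x])\subset\Bbbk[\![x]\!]$ the ring of differentially algebraic power series. 1. $\mathrm{Der}^{exp}_\Bbbk(R)=(x)^2\cdot \mathrm{Der}_\Bbbk(R)$, i.e. $e^\xi x\in R$ for every $\xi\in(x)^2\cdot \mathrm{Der}_\Bbbk(R)$. 2. For algebraic derivations, $\xi\in(x)^2\cdot \mathrm{Der}_\Bbbk(\Bbbk\langle x\rangle)$, the differential order of $e^\xi x$ is $1$.
   Context: A power series $f\in\Bbbk[\![x]\!]$ is differentially algebraic if the field generated over $\Bbbk$ (i.e. over $\mathrm{Frac}(\Bbbk)$) by $x$, $f$ and all the derivatives of $f$ has finite transcendence degree over $\Bbbk$. Thus $f$ satisfies a nontrivial polynomial ODE $P(x,f,f',\dots,f^{(N)})=0$; the minimal such $N$ is called the differential order of $f$. $D^{alg}(\Bbbk[x])$ is the set of all differentially algebraic power series; it is a differential subalgebra of $\Bbbk[\![x]\!]$. $\Bbbk\langle x\rangle\subset\Bbbk[\![x]\!]$ is the ring of algebraic power series: those $f$ with $p(x,f(x))=0$ for some $0\ne p(x,y)\in\Bbbk[x,y]$. For a ring $S$ equal to $R$ or $\Bbbk\langle x\rangle$, $\mathrm{Der}_\Bbbk(S)$ is the module of $\Bbbk$-linear derivations of $S$, and the elements of $(x)^2\cdot \mathrm{Der}_\Bbbk(S)$ are the derivations $a(x)\partial_x$ with $a\in (x)^2\subset S$. For such $\xi$, $e^\xi:=\sum_{j\ge0}\frac{\xi^j}{j!}$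 is a well-defined automorphism of $\Bbbk[\![x]\!]$. $\mathrm{Der}^{exp}_\Bbbk(R)$ is the set of $x$-adically nilpotent derivations $\xi$ of $R$ (those with $\xi^N(x)\subseteq(x)^2$ for $N\gg1$; in one variable these are exactly the elements of $(x)^2\cdot\mathrm{Der}_\Bbbk(R)$) that are exponentiable over $R$, i.e. $e^\xi x\in R$.
   Formalization: In part 2, ''order is 1'' fails when e^ξ x is algebraic (ξ=0 gives x, ξ=x²∂ₓ gives x/(1−x), both of order 0); what is proved is that the differential order of e^ξ x is at most 1, and exactly 1 whenever e^ξ x is not algebraic. *)

(* Defs.v *)
From HB Require Import structures.
From mathcomp Require Export all_boot all_order all_algebra.
From mathcomp Require Export boolp classical_sets.
From mathcomp Require Export mpoly.

Set Implicit Arguments.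
Unset Strict Implicit.
Unset Printing Implicit Defensive.

Import GRing.Theory.
Local Open Scope ring_scope.
Local Open Scope classical_set_scope.

Section LocalRing.
Variable K : comNzRingType.

Definition is_ideal (I : set K) : Prop :=
  [/\ I 0, forall a b, I a -> I b -> I (a + b) & forall c a, I a -> I (c * a)].

Definition maximal_ideal (I : set K) : Prop :=
  [/\ is_ideal I, ~ I 1
    & forall J, is_ideal J -> ~ J 1 -> I `<=` J -> J = I].

Definition local_ring : Prop := exists! m : set K, maximal_ideal m.

End LocalRing.

Record fps (K : Type) := FPS { fps_coef :> nat -> K }.

HB.instance Definition _ (K : Type) := gen_eqMixin (fps K).
HB.instance Definition _ (K : Type) := gen_choiceMixin (fps K).

Lemma fpsP (K : Type) (f g : fps K) : (forall n, f n = g n) <-> f = g.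
Proof.
split=> [|-> //]; case: f g => [f] [g] /= fg.
by congr FPS; apply/funext.
Qed.

Section FpsRing.
Variable K : comNzRingType.
Implicit Types (f g h : fps K) (a b c : K).

Definition fps_const c : fps K := FPS (fun n => if n == 0%N then c else 0).
Definition fps_add f g : fps K := FPS (fun n => f n + g n).
Definition fps_opp f : fps K := FPS (fun n => - f n).
Definition fps_mul f g : fps K :=
  FPS (fun n => \sum_(i < n.+1) f i * g (n - i)%N).
Definition fps_scale c f : fps K := FPS (fun n => c * f n).

Fact fps_addA : associative fps_add.
Proof. by move=> f g h; apply/fpsP => n /=; rewrite addrA. Qed.
Fact fps_addC : commutative fps_add.
Proof. by move=> f g; apply/fpsP => n /=; rewrite addrC. Qed.
Fact fps_add0 : left_id (fps_const 0) fps_add.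
Proof. by move=> f; apply/fpsP => n /=; case: eqP; rewrite add0r. Qed.
Fact fps_addN : left_inverse (fps_const 0) fps_opp fps_add.
Proof. by move=> f; apply/fpsP => n /=; rewrite addNr; case: eqP. Qed.

HB.instance Definition _ :=
  GRing.isZmodule.Build (fps K) fps_addA fps_addC fps_add0 fps_addN.

(* Polynomial truncation, used to inherit the ring laws from {poly K}. *)
Let tr m f : {poly K} := \poly_(i < m) f i.

Let tr_coef m f n : (n < m)%N -> (tr m f)`_n = f n.
Proof. by move=> nm; rewrite coef_poly nm. Qed.

Let mul_tr m f g n : (n < m)%N -> fps_mul f g n = (tr m f * tr m g)`_n.
Proof.
move=> nm; rewrite coefM /=; apply: eq_bigr => i _.
by rewrite !tr_coef // ?(leq_ltn_trans (leq_subr _ _)) // (leq_trans (ltn_ord i)).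
Qed.

Fact fps_mulC : commutative fps_mul.
Proof.
by move=> f g; apply/fpsP => n; rewrite !(mul_tr _ _ (ltnSn n)) mulrC.
Qed.

Fact fps_mulA : associative fps_mul.
Proof.
move=> f g h; apply/fpsP => n.
transitivity (tr n.+1 f * (tr n.+1 g * tr n.+1 h))`_n.
  rewrite coefM; apply: eq_bigr => i _.
  by rewrite tr_coef // -mul_tr // ltnS leq_subr.
rewrite mulrA coefM; apply: eq_bigr => i _.
by rewrite -mul_tr // tr_coef // ltnS leq_subr.
Qed.

Fact fps_mul1 : left_id (fps_const 1) fps_mul.
Proof.
move=> f; apply/fpsP => n /=; rewrite big_ord_recl /= mul1r subn0.
by rewrite big1 ?addr0 // => i _; rewrite mul0r.
Qed.

Fact fps_mulDl : left_distributive fps_mul fps_add.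
Proof.
move=> f g h; apply/fpsP => n /=; rewrite -big_split /=.
by apply: eq_bigr => i _; rewrite mulrDl.
Qed.

Fact fps_1neq0 : fps_const 1 != 0.
Proof.
by apply/eqP => /fpsP/(_ 0%N)/= /eqP; rewrite oner_eq0.
Qed.

HB.instance Definition _ := GRing.Zmodule_isComNzRing.Build (fps K)
  fps_mulA fps_mulC fps_mul1 fps_mulDl fps_1neq0.

Fact fps_scaleA a b f : fps_scale a (fps_scale b f) = fps_scale (a * b) f.
Proof. by apply/fpsP => n /=; rewrite mulrA. Qed.
Fact fps_scale1 : left_id 1 fps_scale.
Proof. by move=> f; apply/fpsP => n /=; rewrite mul1r. Qed.
Fact fps_scaleDr : right_distributive fps_scale +%R.
Proof. by move=> c f g; apply/fpsP => n /=; rewrite mulrDr. Qed.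
Fact fps_scaleDl f : {morph fps_scale^~ f : a b / a + b}.
Proof. by move=> a b; apply/fpsP => n /=; rewrite mulrDl. Qed.

HB.instance Definition _ := GRing.Zmodule_isLmodule.Build K (fps K)
  fps_scaleA fps_scale1 fps_scaleDr fps_scaleDl.

Fact fps_scaleAl c f g : c *: (f * g) = (c *: f) * g.
Proof.
by apply/fpsP => n /=; rewrite mulr_sumr; apply: eq_bigr => i _; rewrite mulrA.
Qed.

HB.instance Definition _ := GRing.Lmodule_isLalgebra.Build K (fps K) fps_scaleAl.
HB.instance Definition _ := GRing.Lalgebra_isComAlgebra.Build K (fps K).

Definition fps_unit : {pred fps K} := fun f => `[< exists g, g * f = 1 >].
Definition fps_inv f : fps K := xget f [set g | g * f = 1].

Fact fps_mulVf : {in fps_unit, left_inverse 1 fps_inv *%R}.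
Proof.
move=> f /asboolP [g gf]; rewrite /fps_inv.
by case: xgetP => [h _ //|/(_ g)]; case.
Qed.

Fact fps_unitPl f g : g * f = 1 -> fps_unit f.
Proof. by move=> gf; apply/asboolP; exists g. Qed.

Fact fps_inv_out : {in [predC fps_unit], fps_inv =1 id}.
Proof.
move=> f /negP nf; rewrite /fps_inv; case: xgetP => // g _ gf.
by case: nf; apply: fps_unitPl gf.
Qed.

HB.instance Definition _ := GRing.ComNzRing_hasMulInverse.Build (fps K)
  fps_mulVf fps_unitPl fps_inv_out.

Definition fpsX : fps K := FPS (fun n => (n == 1%N)%:R).

Definition fps_deriv f : fps K := FPS (fun n => f n.+1 *+ n.+1).

End FpsRing.

Arguments fpsX {K}.

Section FpsDomain.
Variable K : idomainType.

Fact fps_mulf_eq0 (f g : fps K) : f * g = 0 -> (f == 0) || (g == 0).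
Proof.
move=> fg0; apply/norP => -[f0 g0].
have ex (h : fps K) : h != 0 -> exists n, h n != 0.
  move=> /eqP h0; apply/not_existsP => hn; apply: h0; apply/fpsP => n.
  rewrite -[RHS]/(if n == 0%N then 0 else 0); case: (n == 0%N).
    by have /negP := hn n; rewrite negbK => /eqP.
  by have /negP := hn n; rewrite negbK => /eqP.
case: (ex_minnP (ex f f0)) => m fm mmin; case: (ex_minnP (ex g g0)) => n gn nmin.
have /fpsP/(_ (m + n)%N) /= := fg0.
have lt_mmn : (m < (m + n).+1)%N by rewrite ltnS leq_addr.
rewrite (bigD1 (Ordinal lt_mmn)) //= addKn big1 ?addr0 => [|i ne_i].
  move=> H; suff: f m * g n == 0 by rewrite mulf_eq0 (negPf fm) (negPf gn).
  by rewrite H; case: ifP.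
have [lt_im|lt_mi|eq_im] := ltngtP i m.
- have [->|/mmin] := eqVneq (f i) 0; first by rewrite mul0r.
  by rewrite leqNgt lt_im.
- have [->|/nmin] := eqVneq (g (m + n - i)%N) 0; first by rewrite mulr0.
  by rewrite leqNgt ltn_subLR ?ltn_add2r ?lt_mi // -ltnS.
- by case/eqP: ne_i; apply: val_inj.
Qed.

HB.instance Definition _ :=
  GRing.ComUnitRing_isIntegral.Build (fps K) fps_mulf_eq0.

End FpsDomain.

Section TranscendenceDegree.
Variables (K L : comNzRingType) (iota : K -> L).

Definition alg_dependent (d : nat) (z : 'I_d -> L) : Prop :=
  exists2 P : {mpoly K[d]}, P != 0 & mmap iota z P = 0.

Definition finite_trdeg (E : set L) : Prop :=
  exists d, forall z : 'I_d.+1 -> L, (forall i, E (z i)) -> alg_dependent z.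

End TranscendenceDegree.

Definition gen_subfield (L : fieldType) (G : set L) : set L :=
  [set z | forall E : {pred L}, GRing.divring_closed E ->
             (forall g, G g -> g \in E) -> z \in E].

Section DAlg.
Variable K : idomainType.
Implicit Types (f y : fps K) (S : set (fps K)).

Definition fps_frac_const (c : K) : {fraction (fps K)} := tofrac (c%:A : fps K).

Definition diff_field f : set {fraction (fps K)} :=
  gen_subfield (range fps_frac_const
                `|` [set tofrac fpsX]
                `|` range (fun i => tofrac (iter i (@fps_deriv K) f))).

Definition diff_algebraic : set (fps K) :=
  [set f | finite_trdeg fps_frac_const (diff_field f)].

(* The point (x, f, f', ..., f^(N)). *)
Definition jet (N : nat) f (i : 'I_N.+2) : fps K :=
  if val i is j.+1 then iter j (@fps_deriv K) f else fpsX.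

Definition solves_ode (N : nat) f : Prop :=
  exists2 P : {mpoly K[N.+2]},
    P != 0 & mmap (in_alg (fps K)) (jet (N := N) f) P = 0.

Definition diff_order f (N : nat) : Prop :=
  solves_ode N f /\ forall M, solves_ode M f -> (N <= M)%N.

Definition algebraic_fps : set (fps K) :=
  [set f | exists2 p : {mpoly K[2]},
             p != 0 & mmap (in_alg (fps K)) (fun i => [:: fpsX; f]`_i) p = 0].

(* A derivation of S is represented by any map on K[[x]] that restricts to it;
   the values outside S are irrelevant to all the notions below. *)
Definition Der S : set (fps K -> fps K) :=
  [set xi | [/\ forall f, S f -> S (xi f),
                forall (c : K) f g, S f -> S g ->
                  xi (c *: f + g) = c *: xi f + xi g
              & forall f g, S f -> S g -> xi (f * g) = xi f * g + f * xi g]].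

(* The ideal (x)^k of S. *)
Definition x_ideal S (k : nat) : set (fps K) :=
  [set a | exists2 b, S b & a = fpsX ^+ k * b].

(* Since (x)^2 is principal, the products a * D already form a module. *)
Definition x2Der S : set (fps K -> fps K) :=
  [set xi | exists a D, [/\ x_ideal S 2 a, Der S D
                          & forall f, S f -> xi f = a * D f]].

Definition x_nilpotent S (xi : fps K -> fps K) : Prop :=
  exists N0, forall N, (N0 <= N)%N ->
    forall f, x_ideal S 1 f -> x_ideal S 2 (iter N xi f).

(* y = e^xi f: every coefficient of the partial sums of the exponential series
   is eventually equal to that of y. *)
Definition is_exp (xi : fps K -> fps K) f y : Prop :=
  forall n, exists m0, forall m, (m0 <= m)%N ->
    (\sum_(j < m) (j`!%:R : K)^-1 *: iter j xi f) n = y n.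

Definition Der_exp S : set (fps K -> fps K) :=
  [set xi | [/\ Der S xi, x_nilpotent S xi
              & exists2 y, is_exp xi fpsX y & S y]].

End DAlg.

(* Main.v *)
(* On a subalgebra of K[[x]] closed under [f |-> (f - f(0)) / x], every
   derivation is [c d/dx] with [c] the image of [x], and nilpotency forces [c] to
   be divisible by [x^2]. For such a vector field [xi = b d/dx], [h = e^xi] is a ring
   endomorphism of K[[x]] commuting with [xi], so [y = h(x)] satisfies
   [b y' = h(b)], and more generally [b h(f)' = h(b) h(f')]. An endomorphism
   transports polynomial relations, so if the derivatives of [b] generate a field
   of finite transcendence degree, so do their images under [h]; together with [x]
   and [y] both families generate an algebra A with [b A' <= A], and all
   derivatives of [y] lie in A[1/b]. If [b] is algebraic, then [h(b)] is algebraic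
   over K(y), hence [y' = h(b) / b] is algebraic over K(x, y).
   Transcendence degrees are compared through Steinitz' exchange lemma for
   relative algebraic closure. *)
From HB Require Import structures.
From mathcomp Require Import ring.
Require Import Defs.

Set Implicit Arguments.
Unset Strict Implicit.
Unset Printing Implicit Defensive.

Import GRing.Theory.
Local Open Scope ring_scope.
Local Open Scope classical_set_scope.

(** * Generated subfields and their elements as fractions *)

Definition set_pred (T : Type) (A : set T) : {pred T} := fun z => `[< A z >].

Lemma set_predP (T : Type) (A : set T) z : reflect (A z) (z \in set_pred A).
Proof. exact: asboolP. Qed.

Section GenSubfield.
Variables (L : fieldType) (G : set L).

Definition gsf_pred : {pred L} := set_pred (gen_subfield G).

Lemma gsf_predP z : reflect (gen_subfield G z) (z \in gsf_pred).
Proof. exact: set_predP. Qed.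

Fact gsf_divring_closed : divring_closed gsf_pred.
Proof.
split=> [|x y /gsf_predP Gx /gsf_predP Gy|x y /gsf_predP Gx /gsf_predP Gy];
  apply/gsf_predP=> E divE GE; case: (divE) => E1 EB EM //.
  by apply: EB; [apply: Gx | apply: Gy].
by apply: EM; [apply: Gx | apply: Gy].
Qed.

HB.instance Definition _ := GRing.isDivringClosed.Build L gsf_pred gsf_divring_closed.

(** The generated subfield becomes a field type of its own, with its embedding in [L], so that the
    theory of [algebraicOver] applies to it. *)
Record gsf := Gsf { gsf_val :> L; _ : gsf_val \in gsf_pred }.

HB.instance Definition _ := [isSub for gsf_val].
HB.instance Definition _ := [Choice of gsf by <:].
HB.instance Definition _ := GRing.SubChoice_isSubIntegralDomain.Build L gsf_pred gsf
  gsf_divring_closed.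
HB.instance Definition _ := [SubIntegralDomain_isSubField of gsf by <:].

Definition gsf_inj : {rmorphism gsf -> L} := val.

Lemma gsf_injP (a : gsf) : gen_subfield G (gsf_inj a).
Proof. by case: a => a /= /asboolP. Qed.

Lemma gsf_lift z : gen_subfield G z -> exists a : gsf, gsf_inj a = z.
Proof. by move=> Gz; exists (Gsf (asboolT Gz)). Qed.

Lemma gen_subfield_base : G `<=` gen_subfield G.
Proof. by move=> z Gz E _; apply. Qed.

End GenSubfield.

Section Fractions.
Variables (A : comNzRingType) (L : fieldType) (ev : {rmorphism A -> L}).

Definition fractions : set L :=
  [set z | exists u v, ev v != 0 /\ z = ev u / ev v].

(** The fractions are closed under subtraction and division, so they are among the sets whose
    intersection is the generated subfield. *)
Lemma gen_subfield_fractions G : G `<=` fractions -> gen_subfield G `<=` fractions.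
Proof.
move=> GE z /(_ (set_pred fractions)) zE; apply/set_predP/zE; last first.
  by move=> g /GE; apply: asboolT.
split=> [|_ _ /set_predP[u [v [v0 ->]]] /set_predP[u' [v' [v0' ->]]]|
  _ _ /set_predP[u [v [v0 ->]]] /set_predP[u' [v' [v0' ->]]]]; apply/set_predP.
- by exists 1, 1; rewrite rmorph1 oner_eq0 divr1.
- exists (u * v' - u' * v), (v * v'); rewrite rmorphB !rmorphM mulf_neq0 //.
  by rewrite -[- (_ / _)]mulNr addf_div // mulNr.
(* Division by zero gives 0, so a vanishing divisor needs its own fraction, 0 / 1. *)
- have [u0|u0] := eqVneq (ev u') 0.
    by exists 0, 1; rewrite rmorph1 oner_eq0 u0 mul0r invr0 mulr0 rmorph0 mul0r.
  exists (u * v'), (v * u'); rewrite !rmorphM mulf_neq0 //.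
  by rewrite invf_div mulf_div.
Qed.

(** A common denominator is built coefficient by coefficient. It turns an equation over a field of
    fractions into one over [A]. *)
Lemma clear_denominators (p : {poly L}) : (forall i, fractions p`_i) ->
  exists q v, ev v != 0 /\ map_poly ev q = ev v *: p.
Proof.
elim/poly_ind: p => [_|p c IH fp].
  by exists 0, 1; rewrite rmorph1 oner_eq0 rmorph0 scaler0.
have [i|q [v [v0 qE]]] := IH.
  by have := fp i.+1; rewrite coefD coefMX coefC addr0.
have [a [b [b0 cE]]] : fractions c.
  by have := fp 0%N; rewrite coefD coefMX coefC add0r.
exists ((b *: q) * 'X + (v * a)%:P), (v * b); rewrite rmorphM mulf_neq0 //; split=> //.
rewrite rmorphD rmorphM /= map_polyX map_polyC /= map_polyZ qE scalerDr.
rewrite -!scalerAl scalerA mulrC; congr (_ + _).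
by rewrite -mul_polyC -polyCM cE rmorphM /=; congr (_%:P); rewrite -mulrA; congr (_ * _);
  rewrite mulrC divfK.
Qed.

End Fractions.

(** * Relative algebraic closure and the exchange property *)

Section AlgebraicClosure.
Variable L : fieldType.
Implicit Types (B C : set L) (z w : L).

Definition acl B : set L := [set z | algebraicOver (@gsf_inj L B) z].

Lemma gen_subfield_acl B : gen_subfield B `<=` acl B.
Proof. by move=> z /gsf_lift[a <-]; apply: algebraic_id. Qed.

Lemma acl_base B : B `<=` acl B.
Proof. by move=> z /gen_subfield_base/gen_subfield_acl. Qed.

Definition acl_pred B : {pred L} := set_pred (acl B).

Lemma acl_predP B z : reflect (acl B z) (z \in acl_pred B).
Proof. exact: set_predP. Qed.

Fact acl_divring_closed B : divring_closed (acl_pred B).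
Proof.
split=> [|x y /acl_predP Bx /acl_predP By|x y /acl_predP Bx /acl_predP By];
  apply/acl_predP.
- exact: algebraic1.
- exact: algebraic_sub.
- exact: algebraic_div.
Qed.

HB.instance Definition _ B :=
  GRing.isDivringClosed.Build L (acl_pred B) (acl_divring_closed B).

Lemma acl_add B z w : acl B z -> acl B w -> acl B (z + w).
Proof. by move=> /acl_predP Bz /acl_predP Bw; apply/acl_predP; apply: rpredD. Qed.

Lemma acl_sub_closed B z w : acl B z -> acl B w -> acl B (z - w).
Proof. by move=> /acl_predP Bz /acl_predP Bw; apply/acl_predP; apply: rpredB. Qed.

Lemma acl_mul B z w : acl B z -> acl B w -> acl B (z * w).
Proof. by move=> /acl_predP Bz /acl_predP Bw; apply/acl_predP; apply: rpredM. Qed.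

Lemma acl_div B z w : acl B z -> acl B w -> acl B (z / w).
Proof. by move=> /acl_predP Bz /acl_predP Bw; apply/acl_predP; apply: rpred_div. Qed.

Lemma gen_subfield_sub_acl B C : B `<=` acl C -> gen_subfield B `<=` acl C.
Proof.
move=> BC z /(_ (acl_pred C) (acl_divring_closed C)) Bz; apply/acl_predP/Bz.
by move=> g /BC/acl_predP.
Qed.

(** Transitivity of algebraicity: over a field algebraic and integral elements agree, and
    integrality passes to roots. *)
Lemma acl_root B (p : {poly L}) z :
  p != 0 -> (forall i, acl B p`_i) -> root p z -> acl B z.
Proof.
move=> p0 Bp pz; apply/integral_algebraic; apply: integral_root pz _ => //.
by move=> _ /(nthP 0)[i _ <-]; apply/integral_algebraic/Bp.
Qed.

Lemma acl_sub B C : B `<=` acl C -> acl B `<=` acl C.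
Proof.
move=> BC z [p p0 pz]; apply: acl_root pz; first by rewrite map_poly_eq0.
by move=> i; rewrite coef_map; apply/(gen_subfield_sub_acl BC)/gsf_injP.
Qed.

Lemma aclS B C : B `<=` C -> acl B `<=` acl C.
Proof. by move=> BC; apply: acl_sub => z /BC/acl_base. Qed.

(** Clearing denominators in the equation of [z] gives a bivariate polynomial [q] over the field of
    [B] that vanishes at [w] (inner variable) and [z] (outer variable). Swapping the variables and
    evaluating the inner one at [z] gives an equation for [w]. *)
Lemma acl_exchange B z w :
  acl (B `|` [set w]) z -> ~ acl B z -> acl (B `|` [set z]) w.
Proof.
pose ev x : {rmorphism {poly gsf B} -> L} := horner_eval x \o map_poly (@gsf_inj L B).
move=> [p p0 pz] nBz.
have BwF : gen_subfield (B `|` [set w]) `<=` fractions (ev w).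
  apply: gen_subfield_fractions => _ [/gen_subfield_base/gsf_lift[a <-]|->].
    exists a%:P, 1; rewrite rmorph1 oner_eq0 divr1 /=; split=> //.
    by rewrite -[RHS]/((map_poly (@gsf_inj L B) a%:P).[w]) map_polyC hornerC.
  exists 'X, 1; rewrite rmorph1 oner_eq0 divr1 /=; split=> //.
  by rewrite -[RHS]/((map_poly (@gsf_inj L B) _).[w]) map_polyX hornerX.
have [i|q [v [v0 qE]]] := @clear_denominators _ _ (ev w) (map_poly (@gsf_inj L _) p).
  by rewrite coef_map; apply/BwF/gsf_injP.
have qw0 : map_poly (ev w) q != 0.
  by rewrite qE scaler_eq0 (negPf v0) map_poly_eq0.
have qwz0 : (map_poly (ev w) q).[z] = 0.
  by rewrite qE hornerZ (rootP pz) mulr0.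
have q0 : q != 0 by apply: contra_neq qw0 => ->; rewrite rmorph0.
pose r := map_poly (ev z) (swapXY q).
apply: (@acl_root _ r).
- have [i ri0] : exists i, (swapXY q)`_i != 0.
    apply/not_existsP => ri; move: q0; rewrite -swapXY_eq0 => /eqP; apply.
    by apply/polyP => i; rewrite coef0; have /negP := ri i; rewrite negbK => /eqP.
  (* The swapped polynomial stays nonzero: a nonzero coefficient vanishing at [z] would make [z]
     algebraic over [B]. *)
  apply/eqP => /polyP/(_ i); rewrite coef_map coef0 => riz; apply: nBz.
  by exists (swapXY q)`_i => //; apply/rootP.
- move=> i; rewrite coef_map -[X in acl _ X]/((map_poly (@gsf_inj L B) _).[z]).
  apply/acl_predP/rpred_horner; last by apply/acl_predP/acl_base; right.
  apply/polyOverP => j; rewrite coef_map; apply/acl_predP.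
  by apply: (@aclS B) => [y By|]; [left | apply/gen_subfield_acl/gsf_injP].
- suff: r.[w] = (map_poly (ev w) q).[z] by rewrite qwz0 => /rootP.
  pose q' := map_poly (map_poly (@gsf_inj L B)) q.
  have -> : map_poly (ev w) q = map_poly (horner_eval w) q'.
    by apply/polyP => i; rewrite !coef_map.
  have -> : r = map_poly (horner_eval z) (swapXY q').
    by rewrite /q' swapXY_map; apply/polyP => i; rewrite !coef_map.
  by rewrite -!horner_swapXY swapXYK -horner2_swapXY.
Qed.

End AlgebraicClosure.

(** * Steinitz' bound on the length of independent sequences *)

Section Independence.
Variable L : fieldType.
Implicit Types (B C : set L) (s t : seq L).

Fixpoint indep B s : Prop :=
  if s is z :: s' then ~ acl B z /\ indep (B `|` [set z]) s' else True.

Lemma indep_rcons B s z :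
  indep B (rcons s z) <-> indep B s /\ ~ acl (B `|` [set` s]) z.
Proof.
elim: s B => [|w s IH] B /=.
  have -> : B `|` [set` [::]] = B by apply/seteqP; split=> x; [case|left].
  by tauto.
have -> : B `|` [set` w :: s] = (B `|` [set w]) `|` [set` s].
  apply/seteqP; split=> x /=; first rewrite in_cons.
    by move=> [Bx|/predU1P[->|sx]]; [left; left|left; right|right].
  by rewrite in_cons => -[[Bx|->]|->]; [left|right; rewrite eqxx|right; rewrite orbT].
have := IH (B `|` [set w]); tauto.
Qed.

(** The elements of [t] are adjoined to [B] one at a time. The first [w] that makes [z] algebraic is
    the one dropped: by exchange, [z] can stand in for it. *)
Lemma acl_swap B t z : acl (B `|` [set` t]) z -> ~ acl B z ->
  exists t', (size t').+1 = size t /\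
    acl (B `|` [set` t]) `<=` acl ((B `|` [set z]) `|` [set` t']).
Proof.
elim: t B => [|w t IH] B Btz nBz.
  case: nBz; suff <- : B `|` [set` [::]] = B by [].
  by apply/seteqP; split=> x; [case|left].
have E C : C `|` [set` w :: t] = (C `|` [set w]) `|` [set` t].
  apply/seteqP; split=> x /=; rewrite in_cons.
    by move=> [Bx|/predU1P[->|sx]]; [left; left|left; right|right].
  by move=> [[Bx|->]|->]; [left|right; rewrite eqxx|right; rewrite orbT].
have [Bwz|nBwz] := pselect (acl (B `|` [set w]) z).
  exists t; split=> //; apply: acl_sub => x [Bx|].
    by apply: acl_base; left; left.
  rewrite /= in_cons => /predU1P[->|tx]; last by apply: acl_base; right.
  by apply: (@aclS _ (B `|` [set z])) (acl_exchange Bwz nBz) => y; left.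
have [|t' [st' Bt']] := IH (B `|` [set w]) _ nBwz; first by rewrite -E.
exists (w :: t'); split; first by rewrite /= st'.
rewrite E; apply: subset_trans Bt' _; apply: aclS => x /=; rewrite in_cons.
by move=> [[[Bx|->]|->]|->]; [left;left|right;rewrite eqxx|left;right|right; rewrite orbT].
Qed.

(** The elements of [s] are swapped in one after the other, and each uses up one element of [t]. *)
Lemma indep_size B s t :
  indep B s -> [set` s] `<=` acl (B `|` [set` t]) -> (size s <= size t)%N.
Proof.
elim: s B t => [//|z s IH] B t [nBz Bzs] sBt.
have [|t' [<- tt']] := @acl_swap B t z _ nBz; first by apply: sBt; rewrite /= mem_head.
by rewrite ltnS; apply: IH Bzs _ => x sx; apply/tt'/sBt; rewrite /= in_cons [x \in s]sx orbT.
Qed.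

End Independence.

(** * Multivariate polynomials as univariate polynomials in the last variable *)

Section MpolyRelations.

Lemma rmorph_mmap (K A A' : comNzRingType) (f : {rmorphism K -> A})
    (h : {rmorphism A -> A'}) n (z : 'I_n -> A) (p : {mpoly K[n]}) :
  h (mmap f z p) = mmap (h \o f) (h \o z) p.
Proof.
rewrite /mmap rmorph_sum; apply: eq_bigr => m _ /=.
by rewrite rmorphM /= /mmap1 rmorph_prod; under eq_bigr do rewrite rmorphXn.
Qed.

Lemma eq_mmap (K A : comNzRingType) (f g : K -> A) n (z z' : 'I_n -> A)
  (p : {mpoly K[n]}) : f =1 g -> z =1 z' -> mmap f z p = mmap g z' p.
Proof.
move=> fg zz'; apply: eq_bigr => m _; rewrite fg; congr (_ * _).
by apply: eq_bigr => i _; rewrite zz'.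
Qed.

Variables (K : comNzRingType) (n : nat).

Let wd : 'I_n -> 'I_n.+1 := widen_ord (leqnSn n).

Lemma horner_mmap_muni (A : comNzRingType) (f : {rmorphism K -> A})
    (z : 'I_n.+1 -> A) (P : {mpoly K[n.+1]}) :
  (map_poly (mmap f (z \o wd)) (muni P)).[z ord_max] = mmap f z P.
Proof.
rewrite muniE rmorph_sum horner_sum /mmap; apply: eq_bigr => m _ /=.
rewrite map_polyZ hornerZ map_polyXn hornerXn /= mmapZ mmapX -mulrA; congr (_ * _).
rewrite /mmap1 big_ord_recr /=; congr (_ * _).
by apply: eq_bigr => i _; rewrite mnmE.
Qed.

(** Evaluating at the variables themselves recovers [P] from [muni P]. *)
Lemma muni_eq0 (P : {mpoly K[n.+1]}) : muni P = 0 -> P = 0.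
Proof.
move=> P0; have := horner_mmap_muni (@mpolyC n.+1 K) (fun i => 'X_i) P.
rewrite P0 rmorph0 horner0 => /esym P0'; rewrite -(comp_mpoly_id P) -[RHS]P0'.
by apply: eq_mmap => // i; rewrite tnth_map tnth_ord_tuple.
Qed.

Lemma muniX_widen i : muni ('X_(wd i) : {mpoly K[n.+1]}) = ('X_i)%:P.
Proof.
rewrite muniE msuppX big_seq1 mcoeffX eqxx scale1r mnm1E.
rewrite (_ : (_ == _) = false) ?expr0 ?alg_polyC; last first.
  by apply/eqP => /(congr1 val) /= /eqP; rewrite ltn_eqF.
congr ('X_[_]%:P); apply/mnmP => j; rewrite mnmE !mnm1E.
by rewrite -val_eqE.
Qed.

Lemma muniX_max : muni ('X_ord_max : {mpoly K[n.+1]}) = 'X.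
Proof.
rewrite muniE msuppX big_seq1 mcoeffX eqxx scale1r mnm1E eqxx expr1.
rewrite (_ : [multinom _ | i < n] = 0%MM) ?mpolyX0 ?scale1r //.
apply/mnmP => j; rewrite mnmE mnm1E mnm0E (_ : (_ == _) = false) //.
by apply/eqP => /(congr1 val) /= /esym /eqP; rewrite ltn_eqF.
Qed.

Lemma muni_widen (p : {mpoly K[n]}) : muni (mwiden p) = p%:P.
Proof.
rewrite /mwiden rmorph_mmap -[in RHS](comp_mpoly_id p) rmorph_mmap.
apply: eq_mmap => [c|i] /=; first by rewrite muniC.
by rewrite muniX_widen tnth_map tnth_ord_tuple.
Qed.

(** An explicit preimage under [muni]: it turns a univariate equation with coefficients in [n]
    variables back into a relation in [n.+1] variables. *)
Lemma muni_horner_widen (q : {poly {mpoly K[n]}}) :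
  muni (map_poly (@mwiden n K) q).['X_ord_max] = q.
Proof.
rewrite -horner_map /= muniX_max -map_poly_comp -[RHS]comp_polyXr /comp_poly.
by congr _.[_]; apply/polyP => i; rewrite !coef_map /= muni_widen.
Qed.

Lemma mmap_widen (A : comNzRingType) (f : {rmorphism K -> A}) (z : 'I_n.+1 -> A)
    (p : {mpoly K[n]}) : mmap f z (mwiden p) = mmap f (z \o wd) p.
Proof.
rewrite /mwiden rmorph_mmap; apply: eq_mmap => [c|i] /=; first by rewrite mmapC.
by rewrite mmapX mmap1U.
Qed.

End MpolyRelations.

(** * Finite transcendence degree in terms of relative algebraic closure *)

Section TrdegAcl.
Variables (K : comNzRingType) (L : fieldType) (f : {rmorphism K -> L}).
Hypothesis f_inj : injective f.

Definition mmap_inj n (z : 'I_n -> L) : Prop := forall P, mmap f z P = 0 -> P = 0.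

Lemma alg_dependentPn n (z : 'I_n -> L) : ~ alg_dependent f z <-> mmap_inj z.
Proof.
split=> [H P Pz|H [P P0 /H/eqP]]; last by rewrite (negPf P0).
by apply: contra_notP H => /eqP P0; exists P.
Qed.

Lemma mmap_inj0 (z : 'I_0 -> L) : mmap_inj z.
Proof.
move=> P; have -> : P = (P@_0%MM)%:MP.
  apply/mpolyP => m; rewrite mcoeffC (_ : m = 0%MM) ?eqxx ?mulr1 //.
  by apply/mnmP => -[].
by rewrite mmapC -(rmorph0 f) => /f_inj ->.
Qed.

(** Peels off the last variable. An equation of [z ord_max] over the field of [w] becomes a relation
    among all values once denominators are cleared. Conversely, a relation read through [muni] is
    such an equation, and it is nonzero because [w] satisfies no relation. *)
Lemma mmap_injS n (z : 'I_n.+1 -> L) (w := z \o widen_ord (leqnSn n)) :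
  mmap_inj z <-> mmap_inj w /\ ~ acl (range f `|` range w) (z ord_max).
Proof.
split=> [zi|[wi nz] P].
  have wi : mmap_inj w.
    move=> P; rewrite -mmap_widen => /zi /(congr1 (@muni _ _)).
    by rewrite muni_widen rmorph0 => /eqP; rewrite polyC_eq0 => /eqP.
  split=> // -[p p0 pz].
  have wF : gen_subfield (range f `|` range w) `<=` fractions (mmap f w).
    apply: gen_subfield_fractions => _ [[c _ <-]|[i _ <-]].
      by exists c%:MP, 1; rewrite rmorph1 oner_eq0 divr1 /= mmapC.
    by exists 'X_i, 1; rewrite rmorph1 oner_eq0 divr1 /= mmapX mmap1U.
  have [i|q [v [v0 qE]]] := @clear_denominators _ _ (mmap f w) (map_poly (@gsf_inj L _) p).
    by rewrite coef_map; apply/wF/gsf_injP.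
  have : mmap f z (map_poly (@mwiden n K) q).['X_ord_max] = 0.
    rewrite -horner_map /= mmapX mmap1U -map_poly_comp.
    have -> : map_poly (mmap f z \o @mwiden n K) q = map_poly (mmap f w) q.
      by apply/polyP => i; rewrite !coef_map /= mmap_widen.
    by rewrite qE hornerZ (rootP pz) mulr0.
  move=> /zi /(congr1 (@muni _ _)); rewrite muni_horner_widen rmorph0 => q0.
  move/eqP: qE; rewrite q0 rmorph0 eq_sym scaler_eq0 (negPf v0) map_poly_eq0.
  by rewrite (negPf p0).
rewrite -horner_mmap_muni => Pz; apply: muni_eq0.
apply: contra_notP nz => /eqP P0; apply: acl_root (introT rootP Pz).
  apply: contra_neq P0 => /polyP P0; apply/polyP => i; rewrite coef0; apply: wi.
  by have := P0 i; rewrite coef_map coef0.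
move=> i; rewrite coef_map /=; apply/acl_predP/rpred_sum => m _.
rewrite rpredM //; first by apply/acl_predP/acl_base; left; exists (muni P)`_i@_m.
by apply: rpred_prod => j _; apply/rpredX/acl_predP/acl_base; right; exists j.
Qed.

Lemma mmap_inj_indep n (z : 'I_n -> L) : mmap_inj z <-> indep (range f) (codom z).
Proof.
elim: n z => [|n IH] z.
  have -> : codom z = [::] by apply: size0nil; rewrite size_codom card_ord.
  by split=> // _; apply: mmap_inj0.
have -> : codom z = rcons (codom (z \o widen_ord (leqnSn n))) (z ord_max).
  by rewrite /codom /image_mem enum_ordSr map_rcons -map_comp.
rewrite indep_rcons -IH mmap_injS.
suff -> : [set` codom (z \o widen_ord (leqnSn n))] = range (z \o widen_ord (leqnSn n)) by [].
apply/seteqP; split=> [x /codomP[i ->]|x [i _ <-]]; first by exists i.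
exact: codom_f.
Qed.

(** By Steinitz, no independent family in [E] is longer than [t], so [d] can be [size t]. *)
Lemma finite_trdeg_acl (E : set L) (t : seq L) :
  E `<=` acl (range f `|` [set` t]) -> finite_trdeg f E.
Proof.
move=> Et; exists (size t) => z Ez; apply: contrapT => /alg_dependentPn.
move=> /mmap_inj_indep/indep_size iz.
suff /iz : [set` codom z] `<=` acl (range f `|` [set` t]).
  by rewrite size_codom card_ord ltnn.
by move=> _ /codomP[i ->]; apply/Et/Ez.
Qed.

(** If no finite part of [E] sufficed, an independent sequence in [E] could be prolonged forever;
    length [d.+1] already contradicts the hypothesis. *)
Lemma acl_finite_trdeg (E : set L) : finite_trdeg f E ->
  exists2 t : seq L, [set` t] `<=` E & E `<=` acl (range f `|` [set` t]).
Proof.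
move=> [d dep]; apply: contrapT => noT.
have H n : exists s : seq L, [/\ size s = n, [set` s] `<=` E & indep (range f) s].
  elim: n => [|n [s [sn sE si]]]; first by exists [::].
  have [z Ez nz] : exists2 z, E z & ~ acl (range f `|` [set` s]) z.
    apply: contrapT => nz; apply: noT; exists s => // z Ez.
    by apply: contrapT => nsz; apply: nz; exists z.
  exists (rcons s z); split; [by rewrite size_rcons sn| |exact/indep_rcons].
  by move=> x /=; rewrite mem_rcons in_cons => /predU1P[->|/sE].
have [s [sd sE si]] := H d.+1.
pose z (i : 'I_d.+1) := s`_i.
have zs : codom z = s.
  apply: (@eq_from_nth _ 0); first by rewrite size_codom card_ord sd.
  move=> i; rewrite size_codom card_ord => id.
  by rewrite (nth_map ord0) ?size_enum_ord // /z nth_enum_ord.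
have : ~ alg_dependent f z by apply/alg_dependentPn/mmap_inj_indep; rewrite zs.
by apply; apply: dep => i; apply: sE; rewrite /= -zs codom_f.
Qed.

End TrdegAcl.

(** * Coefficients, derivative, order and generated subalgebras of power series *)

Section PowerSeries.
Variable K : comNzRingType.
Implicit Types (f g h : fps K) (c : K) (n : nat).

Lemma fps_coefD f g n : (f + g) n = f n + g n. Proof. by []. Qed.
Lemma fps_coefZ c f n : (c *: f) n = c * f n. Proof. by []. Qed.
Lemma fps_coefM f g n : (f * g) n = \sum_(i < n.+1) f i * g (n - i)%N.
Proof. by []. Qed.

Lemma fps_coef0 n : (0 : fps K) n = 0.
Proof. by rewrite -[LHS]/(if n == 0%N then 0 else 0); case: eqP. Qed.

Lemma fps_coef1 n : (1 : fps K) n = (n == 0%N)%:R.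
Proof. by rewrite -[LHS]/(if n == 0%N then 1 else 0); case: eqP. Qed.

Lemma fps_coef_sum I (r : seq I) (P : pred I) (F : I -> fps K) n :
  (\sum_(i <- r | P i) F i) n = \sum_(i <- r | P i) F i n.
Proof. by apply: (big_morph (fun f : fps K => f n)) => //; apply: fps_coef0. Qed.

Lemma fps_coefXM f n : (fpsX * f) n = if n is m.+1 then f m else 0.
Proof.
rewrite fps_coefM; case: n => [|n]; first by rewrite big_ord1 /= mul0r.
rewrite big_ord_recl /= mul0r add0r big_ord_recl /= mul1r subn1 big1 ?addr0 //.
by move=> i _; rewrite mul0r.
Qed.

Lemma fps_coefXn k n : ((fpsX : fps K) ^+ k) n = (n == k)%:R.
Proof.
elim: k n => [|k IH] n; first by rewrite fps_coef1.
by rewrite exprS fps_coefXM; case: n => [|n].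
Qed.

(** This is [(f - f(0)) / x], defined without division. *)
Definition fps_shift f : fps K := FPS (fun n => f n.+1).

Lemma fps_shiftE f : f = (f 0%N)%:A + fpsX * fps_shift f.
Proof.
apply/fpsP => n; rewrite fps_coefD fps_coefXM fps_coefZ fps_coef1.
by case: n => [|n]; rewrite ?mulr1 ?addr0 // mulr0 add0r.
Qed.

Lemma fps_mulX_shift f : fpsX * fps_shift f = f - (f 0%N)%:A.
Proof. by apply/eqP; rewrite eq_sym subr_eq addrC -fps_shiftE. Qed.

Fact fps_deriv_is_linear : linear (@fps_deriv K).
Proof.
move=> c f g; apply/fpsP => n; rewrite fps_coefD fps_coefZ /=.
by rewrite mulrnDl mulrnAr.
Qed.

HB.instance Definition _ := GRing.isLinear.Build K (fps K) (fps K) _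
  (@fps_deriv K) fps_deriv_is_linear.

Lemma fps_derivM f g : fps_deriv (f * g) = fps_deriv f * g + f * fps_deriv g.
Proof.
apply/fpsP => n; rewrite fps_coefD.
rewrite -[LHS]/((f * g) n.+1 *+ n.+1) !fps_coefM -sumrMnl.
(* The factor [n.+1] splits as [i + (n.+1 - i)]: one part differentiates [f], the other [g]. *)
transitivity (\sum_(i < n.+2) (f i * g (n.+1 - i)%N *+ i +
                               f i * g (n.+1 - i)%N *+ (n.+1 - i))).
  by apply: eq_bigr => i _; rewrite -mulrnDr subnKC // -ltnS.
rewrite big_split /=; congr (_ + _).
  rewrite big_ord_recl /= mulr0n add0r; apply: eq_bigr => i _.
  by rewrite mulrnAl.
rewrite big_ord_recr /= subnn mulr0n addr0; apply: eq_bigr => i _.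
by rewrite -mulrnAr subSn // -ltnS.
Qed.

Lemma fps_derivC c : fps_deriv (c%:A : fps K) = 0.
Proof.
apply/fpsP => n; rewrite -[LHS]/((c%:A : fps K) n.+1 *+ n.+1).
by rewrite fps_coef0 fps_coefZ fps_coef1 mulr0 mul0rn.
Qed.

(** The extra factor [f] avoids the exponent [n - 1], which is truncated at [n = 0]. *)
Lemma fps_deriv_exp f n : f * fps_deriv (f ^+ n) = (f ^+ n * fps_deriv f) *+ n.
Proof.
elim: n => [|n IH]; first by rewrite expr0 -[1]scale1r fps_derivC mulr0.
by rewrite exprS fps_derivM mulrDr IH mulrnAr mulrS !mulrA [f * _ * f ^+ n]mulrAC.
Qed.

Lemma fps_derivX : fps_deriv (fpsX : fps K) = 1.
Proof.
apply/fpsP => -[|n]; rewrite fps_coef1 -[LHS]/((_ == 1)%N%:R *+ _) //.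
by rewrite mul0rn.
Qed.

Definition order_ge n f : Prop := forall i, (i < n)%N -> f i = 0.

Lemma order_geM m n f g : order_ge m f -> order_ge n g -> order_ge (m + n) (f * g).
Proof.
move=> fm gn i lti; rewrite fps_coefM big1 // => j _.
have [/fm ->|mj] := ltnP j m; first by rewrite mul0r.
rewrite gn ?mulr0 // -(ltn_add2l m) (leq_ltn_trans _ lti) //.
by rewrite addnBA ?leq_subLR ?leq_add2r // -ltnS.
Qed.

Inductive subalg_gen (G : set (fps K)) : fps K -> Prop :=
| subalg_const c : subalg_gen G c%:A
| subalg_base f of G f : subalg_gen G f
| subalg_add f g of subalg_gen G f & subalg_gen G g : subalg_gen G (f + g)
| subalg_mul f g of subalg_gen G f & subalg_gen G g : subalg_gen G (f * g).

(** Since [b d/dx] is a derivation that kills constants, stability needs checking on generators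
    only. *)
Lemma subalg_deriv G b f :
  (forall g, G g -> subalg_gen G (b * fps_deriv g)) ->
  subalg_gen G f -> subalg_gen G (b * fps_deriv f).
Proof.
move=> Gb; elim=> {f} [c|f /Gb //|f g _ IHf _ IHg|f g Gf IHf Gg IHg].
- by rewrite fps_derivC mulr0 -(scale0r 1); apply: subalg_const.
- by rewrite linearD mulrDr; apply: subalg_add.
- rewrite fps_derivM mulrDr mulrA mulrCA; apply: subalg_add; exact: subalg_mul.
Qed.

Lemma subalg_sub G f g : subalg_gen G f -> subalg_gen G g -> subalg_gen G (f - g).
Proof.
move=> Gf Gg; rewrite -mulN1r -scaleN1r; apply/subalg_add/subalg_mul => //.
exact: subalg_const.
Qed.

Lemma subalg_exp G f k : subalg_gen G f -> subalg_gen G (f ^+ k).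
Proof.
move=> Gf; elim: k => [|k IH]; last by rewrite exprS; apply: subalg_mul.
by rewrite expr0 -[1]scale1r; apply: subalg_const.
Qed.

End PowerSeries.

(** Every derivative of [g] lies in the localisation at [b] of the subalgebra. *)
Lemma subalg_deriv_iter (K : comNzRingType) (G : set (fps K)) b g k j :
  subalg_gen G b -> (forall h, G h -> subalg_gen G (b * fps_deriv h)) ->
  subalg_gen G (b ^+ k * g) ->
  exists l, subalg_gen G (b ^+ l * iter j (@fps_deriv K) g).
Proof.
move=> Gb Gd Gg; elim: j => [|j [l]]; first by exists k.
(* Each derivative costs two powers of [b]: one so that the derivative of [b ^+ l * u] is covered by
   [Gd], one so that the correction term contains [b'] only as [b * b']. *)
set u := iter j _ g => Gu; exists l.+2; rewrite iterS -/u.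
have -> : b ^+ l.+2 * fps_deriv u = b * (b * fps_deriv (b ^+ l * u)) -
    l%:R%:A * (b ^+ l * u) * (b * fps_deriv b).
  rewrite fps_derivM mulrDr (mulrA b _ u) fps_deriv_exp scaler_nat !exprS.
  by rewrite -mulr_natl; ring.
apply: subalg_sub; apply: subalg_mul => //; try exact: subalg_deriv.
by apply: subalg_mul => //; apply: subalg_const.
Qed.

(** * Vector fields [b d/dx] and their exponentials *)

Definition fps_vf (K : comNzRingType) (b f : fps K) : fps K := b * fps_deriv f.

Fact fps_vf_is_linear (K : comNzRingType) (b : fps K) : linear (fps_vf b).
Proof. by move=> c f g; rewrite /fps_vf linearP mulrDr scalerAr. Qed.

HB.instance Definition _ (K : comNzRingType) (b : fps K) :=
  GRing.isLinear.Build K (fps K) (fps K) _ (fps_vf b) (fps_vf_is_linear b).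

Section Exponential.
Variables (K : idomainType) (b : fps K).
Hypothesis natK : forall n, (n.+1%:R : K) \is a GRing.unit.
Hypothesis b_ord : order_ge 2 b.
Implicit Types f g : fps K.

Local Notation xi := (fps_vf b).

Let xiM f g : xi (f * g) = xi f * g + f * xi g.
Proof. by rewrite /fps_vf fps_derivM; ring. Qed.

(** Differentiation lowers the order by at most one and [b] raises it by two. The case [m = 0] is
    apart because [m - 1] would be truncated. *)
Let xi_ord m f : order_ge m f -> order_ge m.+1 (xi f).
Proof.
case: m => [_ [|//] _|m fm].
  by rewrite /fps_vf fps_coefM big_ord1 b_ord // mul0r.
rewrite /fps_vf -add2n; apply: order_geM => // i im.
by rewrite /= fm // mul0rn.
Qed.

Lemma natK_fact n : (n`!%:R : K) \is a GRing.unit.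
Proof.
by elim: n => [|n IH]; rewrite ?unitr1 // factS natrM unitrM natK.
Qed.

(* The terms of e^xi f, as a power series over the power series ring: the Leibniz
   rule makes this multiplicative in f. *)
Definition exp_terms f : fps (fps K) := FPS (fun j => (j`!%:R : K)^-1 *: iter j xi f).

Lemma exp_terms0 f : exp_terms f 0%N = f.
Proof. by rewrite /= invr1 scale1r. Qed.

(** With [j] read as the exponent of an auxiliary variable [T], this is the differential equation
    [d/dT = xi] of the flow. *)
Lemma exp_termsS f j : exp_terms f j.+1 *+ j.+1 = xi (exp_terms f j).
Proof.
rewrite /= linearZ /= -scaler_nat scalerA factS natrM invrM ?natK ?natK_fact //.
by rewrite mulrCA mulrV ?natK // mulr1.
Qed.

(** Uniqueness for this equation: each term determines the next because [j.+1] is invertible in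
    [K]. *)
Lemma exp_terms_eq (h h' : fps (fps K)) : h 0%N = h' 0%N ->
  (forall j, h j.+1 *+ j.+1 = xi (h j)) -> (forall j, h' j.+1 *+ j.+1 = xi (h' j)) ->
  h = h'.
Proof.
move=> h0 hS hS'; apply/fpsP; elim=> [//|j IH].
have : h j.+1 *+ j.+1 = h' j.+1 *+ j.+1 by rewrite hS hS' IH.
rewrite -!scaler_nat => /(congr1 ( *:%R (j.+1%:R : K)^-1)).
by rewrite !scalerA mulVr ?natK // !scale1r.
Qed.

(** Both sides solve [d/dT = xi] with initial value [f * g]; for the product this is the Leibniz
    rule in [T] combined with that of [xi]. *)
Lemma exp_termsM f g : exp_terms (f * g) = exp_terms f * exp_terms g.
Proof.
apply: exp_terms_eq => [|j|j].
- by rewrite exp_terms0 fps_coefM big_ord1 !exp_terms0.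
- exact: exp_termsS.
- have /fpsP/(_ j) := fps_derivM (exp_terms f) (exp_terms g).
  rewrite -[LHS]/((exp_terms f * exp_terms g) j.+1 *+ j.+1) => ->.
  rewrite fps_coefD !fps_coefM -big_split linear_sum; apply: eq_bigr => i _.
  by rewrite [RHS]xiM -!exp_termsS.
Qed.

Lemma exp_terms_ord f j : order_ge j (exp_terms f j).
Proof.
move=> i ij; rewrite fps_coefZ (_ : iter j xi f i = 0) ?mulr0 //.
by elim: j i ij => [|j IH] i //; apply: xi_ord => {}i; apply: IH.
Qed.

(** The sum may stop at [j = n]: when [b] has order at least 2, the [j]-th term has order at least
    [j]. *)
Definition fps_exp f : fps K := FPS (fun n => \sum_(j < n.+1) exp_terms f j n).

Lemma fps_exp_trunc f n N :
  (n < N)%N -> fps_exp f n = (\sum_(j < N) exp_terms f j) n.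
Proof.
move=> nN; rewrite fps_coef_sum -[LHS]/(\sum_(j < n.+1) exp_terms f j n).
rewrite -!(big_mkord xpredT (fun j => exp_terms f j n)).
rewrite [RHS](big_cat_nat _ (n := n.+1)) // [X in _ = _ + X]big_nat_cond.
rewrite [X in _ = _ + X]big1 ?addr0 // => j /andP[/andP[nj _] _].
exact: exp_terms_ord.
Qed.

Fact fps_exp_is_linear : linear fps_exp.
Proof.
move=> c f g; apply/fpsP => n.
rewrite fps_coefD fps_coefZ /= mulr_sumr -big_split /=; apply: eq_bigr => j _.
have -> : iter j xi (c *: f + g) = c *: iter j xi f + iter j xi g.
  by elim: (val j) => //= i ->; rewrite linearP.
by rewrite mulrDr mulrCA.
Qed.

Lemma fps_expM f g : fps_exp (f * g) = fps_exp f * fps_exp g.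
Proof.
apply/fpsP => n; rewrite fps_coefM.
(* The truncated exponentials are polynomials in [T], evaluated at 1. Up to degree [n] their product
   has the coefficients of [exp_terms (f * g)]; the remaining degrees must not contribute. *)
pose S (h : fps K) := \poly_(j < n.+1) exp_terms h j.
have SE h i : (i < n.+1)%N -> fps_exp h i = (S h).[1] i.
  move=> ni; rewrite (fps_exp_trunc _ ni) horner_poly.
  by under [in RHS]eq_bigr do rewrite expr1n mulr1.
transitivity (((S f).[1] * (S g).[1]) n); last first.
  rewrite fps_coefM; apply: eq_bigr => i _; rewrite !SE //.
  by rewrite ltnS leq_subr.
rewrite -hornerM.
have sz : (size (S f * S g)%R <= n.+1 + n.+1)%N.
  apply: leq_trans (size_polyMleq _ _) _; apply: leq_trans (leq_pred _) _.
  by rewrite leq_add ?size_poly.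
rewrite (horner_coef_wide _ sz) fps_coef_sum big_split_ord.
rewrite [X in _ = _ + X]big1 ?addr0 => [|i _].
  apply: eq_bigr => i _; rewrite expr1n mulr1 exp_termsM; congr (fps_coef _ n).
  rewrite coefM; apply: eq_bigr => j _; rewrite !coef_poly.
  have li : (i < n.+1)%N := ltn_ord i; have lj : (j < i.+1)%N := ltn_ord j.
  by rewrite !ifT // ?(leq_trans lj) // (leq_ltn_trans (leq_subr _ _)).
(* In degree [n.+1 + i], every summand has order at least [n.+1 + i] in [x], or is zero by
   truncation, so its coefficient at [n] vanishes. *)
rewrite expr1n mulr1 coefM fps_coef_sum big1 // => j _.
rewrite !coef_poly; case: ifP => _; last by rewrite mul0r fps_coef0.
case: ifP => _; last by rewrite mulr0 fps_coef0.
have lj : (j < (n.+1 + i).+1)%N := ltn_ord j.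
apply: (order_geM (@exp_terms_ord f j) (@exp_terms_ord g (n.+1 + i - j))).
by rewrite subnKC // addSn ltnS leq_addr.
Qed.

Lemma fps_expC c : fps_exp c%:A = c%:A.
Proof.
have H j : iter j.+1 xi (c%:A : fps K) = 0.
  rewrite iterSr /fps_vf fps_derivC mulr0 -/(fps_vf b).
  by elim: j => //= j ->; rewrite linear0.
apply/fpsP => n; rewrite -[LHS]/(\sum_(j < n.+1) exp_terms c%:A j n).
rewrite big_ord_recl exp_terms0 big1 ?addr0 // => i _.
by rewrite fps_coefZ [iter _ _ _]H fps_coef0 mulr0.
Qed.

Fact fps_exp_is_monoid : monoid_morphism fps_exp.
Proof. by split; [rewrite -[1]scale1r fps_expC | exact: fps_expM]. Qed.

Definition fps_exp_rmorph : {rmorphism fps K -> fps K} :=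
  HB.pack fps_exp
    (GRing.isZmodMorphism.Build _ _ fps_exp (zmod_morphism_linear fps_exp_is_linear))
    (GRing.isMonoidMorphism.Build _ _ fps_exp fps_exp_is_monoid).

(** [xi] commutes with its own iterates, hence with [fps_exp], which is moreover multiplicative. *)
Lemma fps_exp_flow f : b * fps_deriv (fps_exp f) = fps_exp b * fps_exp (fps_deriv f).
Proof.
have E j : xi (exp_terms f j) = exp_terms (xi f) j.
  by rewrite /= linearZ /= -iterS iterSr.
rewrite -fps_expM; apply/fpsP => n.
(* Terms up to [n.+1] are kept because the derivative reads one coefficient further. *)
transitivity (xi (\sum_(j < n.+2) exp_terms f j) n).
  rewrite !fps_coefM; apply: eq_bigr => i _; congr (_ * _).
  rewrite -[LHS]/(fps_exp f (n - i).+1 *+ (n - i).+1) (@fps_exp_trunc f _ n.+2) //.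
  by rewrite ltnS ltnS leq_subr.
rewrite linear_sum (@fps_exp_trunc _ n n.+2) // !fps_coef_sum; apply: eq_bigr => j _.
by rewrite -E.
Qed.

Lemma fps_exp_is_exp f : is_exp xi f (fps_exp f).
Proof.
move=> n; exists n.+1 => m nm; rewrite (fps_exp_trunc _ nm) //.
Qed.

End Exponential.

(** Treated apart, since the later arguments divide by [b]. *)
Lemma fps_exp0 (K : idomainType) (f : fps K) : fps_exp 0 f = f.
Proof.
apply/fpsP => n; rewrite -[LHS]/(\sum_(j < n.+1) exp_terms 0 f j n).
rewrite big_ord_recl exp_terms0 big1 ?addr0 // => i _.
by rewrite fps_coefZ [iter _ _ _]mul0r fps_coef0 mulr0.
Qed.

(** * Differentially algebraic series and their closure properties *)

Section FractionField.
Variables (K : idomainType) (L : fieldType) (tf : {rmorphism fps K -> L}).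
Hypothesis tf_inj : injective tf.
Implicit Types (f g y : fps K) (t : seq L) (A : set (fps K)).

Definition frac_in : {rmorphism K -> L} := tf \o in_alg (fps K).

Lemma tf_eq0 f : (tf f == 0) = (f == 0).
Proof. by rewrite -(rmorph0 tf) (inj_eq tf_inj). Qed.

(** For [tf := tofrac] this is [diff_algebraic]; the argument works with any injective morphism to a
    field. *)
Definition tf_diff_algebraic f : Prop := finite_trdeg frac_in
  (gen_subfield (range frac_in `|` [set tf fpsX]
                 `|` range (fun i => tf (iter i (@fps_deriv K) f)))).

Lemma frac_in_inj : injective frac_in.
Proof.
move=> c d /tf_inj/fpsP/(_ 0%N).
by rewrite !fps_coefZ fps_coef1 !mulr1.
Qed.

Lemma tf_mmap n (z : 'I_n -> fps K) (P : {mpoly K[n]}) :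
  mmap frac_in (tf \o z) P = tf (mmap (in_alg (fps K)) z P).
Proof. by rewrite rmorph_mmap. Qed.

Lemma alg_dependent_tf n (z : 'I_n -> fps K) :
  alg_dependent frac_in (tf \o z) <-> alg_dependent (in_alg (fps K)) z.
Proof.
split=> -[P P0 Pz]; exists P => //; last by rewrite tf_mmap Pz rmorph0.
by apply: tf_inj; rewrite -tf_mmap Pz rmorph0.
Qed.

Lemma alg_dependent_rmorph (h : {rmorphism fps K -> fps K}) n (z : 'I_n -> fps K) :
  (forall c : K, h c%:A = c%:A) ->
  alg_dependent (in_alg (fps K)) z -> alg_dependent (in_alg (fps K)) (h \o z).
Proof.
move=> hC [P P0 Pz]; exists P; first exact: P0.
have := congr1 h Pz; rewrite rmorph_mmap rmorph0 => <-.
by apply: eq_mmap => // c; rewrite -[LHS]hC.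
Qed.

(** Relations are transported tuple by tuple among power series, because [h] need not extend to the
    fraction field. *)
Lemma finite_trdeg_rmorph (h : {rmorphism fps K -> fps K}) A :
  (forall c : K, h c%:A = c%:A) ->
  finite_trdeg frac_in (tf @` A) ->
  finite_trdeg frac_in (tf @` (h @` A)).
Proof.
move=> hC [d dA]; exists d => z zA.
have /choice[w wP] : forall i, exists a, A a /\ z i = tf (h a).
  by move=> i; have [_ [a Aa <-] <-] := zA i; exists a.
have -> : z = tf \o (h \o w) by apply/funext => i; have [] := wP i.
apply/alg_dependent_tf/alg_dependent_rmorph => //; apply/alg_dependent_tf/dA.
by move=> i; exists (w i) => //; have [] := wP i.
Qed.

Definition aclx t : set L := acl (range frac_in `|` ([set tf fpsX] `|` [set` t])).

Lemma aclxS t t' : {subset t <= t'} -> aclx t `<=` aclx t'.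
Proof.
move=> tt'; apply: aclS => z [kz|[xz|tz]]; [by left|by right; left|right; right].
exact: tt'.
Qed.

Lemma aclx_X t : aclx t (tf fpsX).
Proof. by apply: acl_base; right; left. Qed.

Lemma aclx_in t c : aclx t (frac_in c).
Proof. by apply: acl_base; left; exists c. Qed.

Lemma aclx_subalg t A f : (forall g, A g -> aclx t (tf g)) ->
  subalg_gen A f -> aclx t (tf f).
Proof.
move=> At; elim=> {f} [c|f /At //|f g _ Hf _ Hg|f g _ Hf _ Hg].
- exact: aclx_in.
- by rewrite rmorphD; apply: acl_add.
- by rewrite rmorphM; apply: acl_mul.
Qed.

Lemma diff_algebraic_aclx f t :
  (forall j, aclx t (tf (iter j (@fps_deriv K) f))) -> tf_diff_algebraic f.
Proof.
move=> ft; apply: (@finite_trdeg_acl _ _ _ frac_in_inj _ (tf fpsX :: t)).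
have E : range frac_in `|` [set` tf fpsX :: t] =
    range frac_in `|` ([set tf fpsX] `|` [set` t]).
  apply/seteqP; split=> z /=; rewrite in_cons.
    by move=> [kz|/predU1P[->|tz]]; [left|right; left|right; right].
  by move=> [kz|[->|->]]; [left|right; rewrite eqxx|right; rewrite orbT].
rewrite E; apply: gen_subfield_sub_acl => _ [[[c _ <-]|->]|[j _ <-]].
- exact: aclx_in.
- exact: aclx_X.
- exact: ft.
Qed.

Lemma finite_trdeg_diff_algebraic f : tf_diff_algebraic f ->
  finite_trdeg frac_in
    (tf @` ([set fpsX] `|` range (fun j => iter j (@fps_deriv K) f))).
Proof.
move=> [d df]; exists d => z zf; apply: df => i; apply: gen_subfield_base.
by have [_ [->|[j _ <-]] <-] := zf i; [left; right|right; exists j].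
Qed.

Lemma finite_trdeg_aclx A : finite_trdeg frac_in (tf @` A) ->
  exists t, forall g, A g -> aclx t (tf g).
Proof.
move=> /(acl_finite_trdeg frac_in_inj)[t _ At]; exists t => g Ag.
apply: (@aclS _ (range frac_in `|` [set` t])) => [z [kz|tz]|]; first by left.
  by right; right.
by apply: At; exists g.
Qed.

(** The working criterion: since a relative algebraic closure is a field, it is enough to look at
    the derivatives themselves instead of the field they generate. *)
Lemma diff_algebraicP f : tf_diff_algebraic f <->
  exists t, forall j, aclx t (tf (iter j (@fps_deriv K) f)).
Proof.
split=> [/finite_trdeg_diff_algebraic/finite_trdeg_aclx|[t]]; last first.
  exact: diff_algebraic_aclx.
by move=> [t ft]; exists t => j; apply: ft; right; exists j.
Qed.

(** The tool behind the closure properties and the flow: all derivatives of [f] lie in the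
    localisation at [b] of the algebra generated by [G], and the field [aclx t] contains that
    localisation. *)
Lemma diff_algebraic_localised (G : set (fps K)) t b k f :
  b != 0 -> subalg_gen G b -> (forall h, G h -> subalg_gen G (b * fps_deriv h)) ->
  (forall h, G h -> aclx t (tf h)) -> subalg_gen G (b ^+ k * f) ->
  tf_diff_algebraic f.
Proof.
move=> b0 Gb Gd Gt Gf; apply: (@diff_algebraic_aclx _ t) => j.
have [l] := subalg_deriv_iter j Gb Gd Gf; set u := iter j _ f => Gu.
have -> : tf u = tf (b ^+ l * u) / tf (b ^+ l).
  by rewrite rmorphM mulrAC divff ?mul1r // tf_eq0 expf_neq0.
apply: acl_div; apply: (aclx_subalg Gt) => //.
exact: subalg_exp.
Qed.

Section Jets.
Variables f g : fps K.

Definition jets : set (fps K) :=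
  [set h | h = fpsX \/ exists j, h = iter j (@fps_deriv K) f \/ h = iter j (@fps_deriv K) g].

Lemma jets_deriv h : jets h -> subalg_gen jets (fps_deriv h).
Proof.
move=> [->|[j [->|->]]].
- by rewrite fps_derivX -[1]scale1r; apply: subalg_const.
- by apply: subalg_base; right; exists j.+1; left.
- by apply: subalg_base; right; exists j.+1; right.
Qed.

Lemma jets_l : subalg_gen jets f.
Proof. by apply: subalg_base; right; exists 0%N; left. Qed.

Lemma jets_r : subalg_gen jets g.
Proof. by apply: subalg_base; right; exists 0%N; right. Qed.

Lemma jets_X : subalg_gen jets fpsX.
Proof. by apply: subalg_base; left. Qed.

(** The jets of [f] and [g] are algebraic over [x] and the concatenation [s ++ t]. Sums and products
    will use [b = 1], the shift [b = x]. *)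
Lemma diff_algebraic_jets b k h : tf_diff_algebraic f -> tf_diff_algebraic g ->
  b != 0 -> subalg_gen jets b -> subalg_gen jets (b ^+ k * h) -> tf_diff_algebraic h.
Proof.
move=> /diff_algebraicP[s fs] /diff_algebraicP[t gt] b0 Gb.
apply: (@diff_algebraic_localised _ (s ++ t)) => //.
  by move=> u /jets_deriv; apply: subalg_mul.
move=> u [->|[j [->|->]]]; first exact: aclx_X.
  by apply: aclxS (fs j) => z zs; rewrite mem_cat zs.
by apply: aclxS (gt j) => z zs; rewrite mem_cat zs orbT.
Qed.

End Jets.

(** The closure properties common to both rings of the theorem, and all that is assumed of a ring
    when its derivations are studied. *)
Definition shift_subalg (S : set (fps K)) : Prop :=
  [/\ S fpsX, forall c : K, S c%:A, forall f g, S f -> S g -> S (f + g),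
    forall f g, S f -> S g -> S (f * g) & forall f, S f -> S (fps_shift f)].

Lemma diff_algebraicX : tf_diff_algebraic (fpsX : fps K).
Proof.
apply: (@diff_algebraic_aclx _ [::]) => -[|[|j]]; first exact: aclx_X.
  by rewrite /= fps_derivX -[1]scale1r; apply: aclx_in.
rewrite iterSr iterSr fps_derivX -[1]scale1r fps_derivC.
suff -> : iter j (@fps_deriv K) 0 = 0 by rewrite -[0](scale0r 1); apply: aclx_in.
by elim: j => //= j ->; rewrite linear0.
Qed.

Lemma diff_algebraic_deriv f : tf_diff_algebraic f -> tf_diff_algebraic (fps_deriv f).
Proof.
move=> /diff_algebraicP[t ft]; apply/diff_algebraicP; exists t => j.
by rewrite -iterSr; apply: ft.
Qed.

Lemma fpsX_neq0 : fpsX != 0 :> fps K.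
Proof.
by apply/eqP => /fpsP/(_ 1%N) /=/eqP; rewrite oner_eq0.
Qed.

Lemma diff_algebraic_subalg : shift_subalg tf_diff_algebraic.
Proof.
have one_neq0 : 1 != 0 :> fps K := oner_neq0 _.
have J1 f g : subalg_gen (jets f g) 1 by rewrite -[1]scale1r; apply: subalg_const.
split=> [|c|f g Rf Rg|f g Rf Rg|f Rf].
- exact: diff_algebraicX.
- apply: (diff_algebraic_jets (k := 0) diff_algebraicX diff_algebraicX one_neq0) => //.
  by rewrite mul1r; apply: subalg_const.
- apply: (diff_algebraic_jets (k := 0) Rf Rg one_neq0) => //.
  by rewrite mul1r; apply: subalg_add; [apply: jets_l|apply: jets_r].
- apply: (diff_algebraic_jets (k := 0) Rf Rg one_neq0) => //.
  by rewrite mul1r; apply: subalg_mul; [apply: jets_l|apply: jets_r].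
- apply: (diff_algebraic_jets (k := 1) Rf Rf fpsX_neq0); first exact: jets_X.
  rewrite expr1 fps_mulX_shift.
  by apply: subalg_sub; [apply: jets_l|apply: subalg_const].
Qed.

Lemma diff_algebraic_flow (h : {rmorphism fps K -> fps K}) b :
  (forall c : K, h c%:A = c%:A) -> b != 0 ->
  (forall f, b * fps_deriv (h f) = h b * h (fps_deriv f)) ->
  tf_diff_algebraic b -> tf_diff_algebraic (h fpsX).
Proof.
move=> hC b0 flow /finite_trdeg_diff_algebraic.
(* [A] consists of [x] and the derivatives of [b]; as it contains [fpsX], its image under [h]
   contains the series [h fpsX] itself. *)
set A := _ `|` _ => Ab; have [t At] := finite_trdeg_aclx Ab.
have [s hAs] := finite_trdeg_aclx (finite_trdeg_rmorph hC Ab).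
pose G := A `|` h @` A.
have AG f : A f -> subalg_gen G f by move=> Af; apply: subalg_base; left.
have hG f : A f -> subalg_gen G (h f).
  by move=> Af; apply: subalg_base; right; exists f.
have AX : A fpsX by left.
have Aj j : A (iter j (@fps_deriv K) b) by right; exists j.
have G1 : subalg_gen G 1 by rewrite -[1]scale1r; apply: subalg_const.
apply: (@diff_algebraic_localised G (t ++ s) b 0 _ b0 (AG _ (Aj 0%N))).
- move=> _ [[->|[j _ <-]]|[_ [->|[j _ <-]] <-]].
  + by rewrite fps_derivX; apply: subalg_mul => //; apply: AG (Aj 0%N).
  + by apply: subalg_mul; [apply: AG (Aj 0%N)|apply: AG (Aj j.+1)].
  + by rewrite flow fps_derivX rmorph1; apply: subalg_mul => //; apply: hG (Aj 0%N).
  + by rewrite flow; apply: subalg_mul; [apply: hG (Aj 0%N)|apply: hG (Aj j.+1)].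
- move=> g [Ag|hAg]; [apply: aclxS (At _ Ag)|apply: aclxS (hAs _ hAg)] => z zt.
    by rewrite mem_cat zt.
  by rewrite mem_cat zt orbT.
- by rewrite mul1r; apply: hG.
Qed.

(** * Algebraic series and equations of order at most one *)

Local Notation Kf := (range frac_in).

Definition nth_dependent (s : seq (fps K)) : Prop :=
  alg_dependent (in_alg (fps K)) (fun i : 'I_(size s) => s`_i).

Lemma nth_dependentP (s : seq (fps K)) : nth_dependent s <-> ~ indep Kf (map tf s).
Proof.
rewrite /nth_dependent -alg_dependent_tf.
set z := _ \o _; have <- : codom z = map tf s.
  apply: (@eq_from_nth _ 0); first by rewrite size_codom size_map card_ord.
  move=> i; rewrite size_codom card_ord => si.
  rewrite (nth_map (Ordinal si)) ?size_enum_ord // (nth_map 0) // /z /=.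
  by rewrite (nth_enum_ord _ si).
rewrite -(mmap_inj_indep frac_in_inj) -alg_dependentPn.
by split=> [dep ndep|]; [apply: ndep|apply: contrapT].
Qed.

(** Evaluated at [x], a polynomial becomes the power series with the same coefficients, so it
    vanishes only if they all do. *)
Lemma fpsX_transcendental : ~ acl Kf (tf fpsX).
Proof.
suff : ~ nth_dependent [:: fpsX] by rewrite nth_dependentP /=; tauto.
move=> [P /eqP P0 Pz]; apply: P0; apply/mpolyP => m; rewrite mcoeff0.
have /fpsP/(_ (m ord0)) := Pz; rewrite fps_coef0 fps_coef_sum => <-.
have E (m' : 'X_{1..1}) : (in_alg (fps K) P@_m' *
    mmap1 (fun i : 'I_1 => [:: fpsX]`_i) m') (m ord0) = P@_m' * (m' == m)%:R.
  rewrite -[in_alg _ _]/(P@_m' *: (1 : fps K)) -scalerAl mul1r fps_coefZ /mmap1 big_ord1.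
  rewrite fps_coefXn; congr (_ * _%:R).
  rewrite eq_sym; congr nat_of_bool; apply/eqP/eqP => [mm|-> //].
  by apply/mnmP => i; rewrite ord1.
under eq_bigr do rewrite E.
have [mP|mP] := boolP (m \in msupp P).
  rewrite (big_rem m) //= eqxx mulr1 big1_seq ?addr0 // => m' /andP[_].
  rewrite mem_rem_uniq ?msupp_uniq // inE => /andP[mm' _].
  by rewrite (_ : (m' == m) = false) ?mulr0 //; apply: negPf mm'.
rewrite (memN_msupp_eq0 mP) big1_seq // => m' /andP[_ m'P].
by case: eqP mP m'P => [<- /negPf ->|]; rewrite ?mulr0.
Qed.

Lemma aclx_nil : aclx [::] = acl (Kf `|` [set tf fpsX]).
Proof.
congr acl; apply/seteqP; split=> z.
  by move=> [kz|[xz|//]]; [left|right].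
by move=> [kz|xz]; [left|right; left].
Qed.

Lemma algebraic_fps_dependent y : algebraic_fps y <-> nth_dependent [:: fpsX; y].
Proof. by []. Qed.

(** As [x] is transcendental over [K], a relation between [x] and [y] makes [y] algebraic over
    [K(x)]. *)
Lemma algebraic_fpsP y : algebraic_fps y <-> aclx [::] (tf y).
Proof.
rewrite algebraic_fps_dependent nth_dependentP aclx_nil /=.
have := fpsX_transcendental; set P := acl _ _; set Q := acl _ _ => nP.
by split=> [|Qy]; [move=> H; apply: contrapT => nQ; apply: H; split|case=> _ []].
Qed.

Lemma algebraic_subalg : shift_subalg (@algebraic_fps K).
Proof.
split=> [|c|f g|f g|f].
- exact/algebraic_fpsP/aclx_X.
- exact/algebraic_fpsP/aclx_in.
- move=> /algebraic_fpsP ff /algebraic_fpsP gg; apply/algebraic_fpsP; rewrite rmorphD.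
  exact: acl_add.
- move=> /algebraic_fpsP ff /algebraic_fpsP gg; apply/algebraic_fpsP; rewrite rmorphM.
  exact: acl_mul.
- move=> /algebraic_fpsP ff; apply/algebraic_fpsP.
  have -> : tf (fps_shift f) = (tf f - tf (f 0%N)%:A) / tf fpsX.
    rewrite -rmorphB -fps_mulX_shift rmorphM.
    by rewrite mulrAC divff ?mul1r // tf_eq0 fpsX_neq0.
  by apply: acl_div; [apply: acl_sub_closed; last exact: aclx_in|exact: aclx_X].
Qed.

Lemma solves_ode0 y : solves_ode 0 y <-> algebraic_fps y.
Proof.
have E (P : {mpoly K[2]}) : mmap (in_alg (fps K)) (jet (N := 0) y) P =
    mmap (in_alg (fps K)) (fun i => [:: fpsX; y]`_i) P.
  by apply: eq_mmap => // -[[|[|i]] //].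
split=> -[P P0 Py]; (exists P; first exact: P0); last by rewrite E.
by rewrite -E.
Qed.

Lemma solves_ode1 y : solves_ode 1 y <-> nth_dependent [:: fpsX; y; fps_deriv y].
Proof.
have E (P : {mpoly K[3]}) : mmap (in_alg (fps K)) (jet (N := 1) y) P =
    mmap (in_alg (fps K)) (fun i => [:: fpsX; y; fps_deriv y]`_i) P.
  by apply: eq_mmap => // -[[|[|[|i]]] //].
split=> -[P P0 Py]; (exists P; first exact: P0); last by rewrite E.
by rewrite -E.
Qed.

Lemma algebraic_ode1 y : algebraic_fps y -> solves_ode 1 y.
Proof.
move=> /algebraic_fpsP ay; apply/solves_ode1/nth_dependentP => -[_ [nXy _]].
by apply: nXy; rewrite -aclx_nil.
Qed.

Lemma rmorph_flow_ode1 (h : {rmorphism fps K -> fps K}) (b : fps K) :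
  (forall c : K, h c%:A = c%:A) -> b != 0 -> algebraic_fps b ->
  b * fps_deriv (h fpsX) = h b -> solves_ode 1 (h fpsX).
Proof.
move=> hC b0 ab flow; set y := h fpsX; apply/solves_ode1/nth_dependentP.
move=> [_ [nXy [nXyy' _]]]; apply: nXyy'.
(* [h] carries the relation between [fpsX] and [b] to one between [y] and [h b]. *)
have : nth_dependent [:: y; h b].
  have [P P0 Pz] := alg_dependent_rmorph hC ab; exists P; first exact: P0.
  by rewrite -[RHS]Pz; apply: eq_mmap => // -[[|[|i]] //].
move=> /nth_dependentP/= H.
(* The relation makes [h b] algebraic over [K(y)] because [y] is transcendental, by the assumed
   independence of [x], [y] and [y']. *)
have yhb : acl (Kf `|` [set tf y]) (tf (h b)).
  apply: contrapT => nyb; apply: H; split; last by split.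
  by apply: contra_not nXy; apply: aclS; left.
have -> : tf (fps_deriv y) = tf (h b) / tf b.
  by rewrite -flow rmorphM mulrAC divff ?mul1r // tf_eq0.
apply: acl_div; first by apply: aclS yhb => z [kz|yz]; [left; left|right].
by move/algebraic_fpsP: ab; rewrite aclx_nil; apply: aclS => z; left.
Qed.

(** Order 0 amounts to being algebraic, so an equation of order 1 leaves no other case than 0 and
    1. *)
Lemma diff_order_le1 y : solves_ode 1 y ->
  (exists2 N, diff_order y N & (N <= 1)%N) /\ (~ algebraic_fps y -> diff_order y 1).
Proof.
move=> y1.
have H : ~ algebraic_fps y -> diff_order y 1.
  by move=> ny; split; [exact: y1|case=> [/solves_ode0/ny []|M _]].
split; last exact: H.
have [/solves_ode0 y0|/H] := pselect (algebraic_fps y).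
  by exists 0%N.
by exists 1%N.
Qed.

End FractionField.

(** * Derivations of subalgebras closed under the shift, and nilpotency *)

Section Derivations.
Variables (K : idomainType) (S : set (fps K)).
Hypothesis S_subalg : shift_subalg S.
Implicit Types (f g b : fps K) (xi D : fps K -> fps K).

Let SX : S fpsX. Proof. by case: S_subalg. Qed.
Let SC c : S c%:A. Proof. by case: S_subalg. Qed.
Let SD f g : S f -> S g -> S (f + g). Proof. by case: S_subalg => _ _ + _ _; apply. Qed.
Let SM f g : S f -> S g -> S (f * g). Proof. by case: S_subalg => _ _ _ + _; apply. Qed.
Let Sshift f : S f -> S (fps_shift f). Proof. by case: S_subalg => _ _ _ _; apply. Qed.
Let S0 : S 0. Proof. by rewrite -(scale0r 1); apply: SC. Qed.
Let S1 : S 1. Proof. by rewrite -[1]scale1r; apply: SC. Qed.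

Lemma shift_subalgXn n : S (fpsX ^+ n).
Proof. by elim: n => [|n IH]; rewrite ?exprS; [apply: S1|apply: SM]. Qed.

(* Writing [f = f(0) + x g], the difference of the two sides for [f] is [x] times
   the difference for [g]; hence it is divisible by every power of [x]. *)
Lemma Der_deriv D f : Der S D -> S f -> D f = D fpsX * fps_deriv f.
Proof.
move=> [_ lin mul]; pose d g := D g - D fpsX * fps_deriv g.
have D1 : D 1 = 0.
  by have := mul _ _ S1 S1; rewrite !mulr1 mul1r -[LHS]addr0 => /addrI.
have D0 : D 0 = 0.
  by have := lin 1 _ _ S0 S0; rewrite scaler0 scale1r addr0 -[LHS]addr0 => /addrI.
have dX g : S g -> d g = fpsX * d (fps_shift g).
  move=> Sg; have Ss := Sshift Sg.
  rewrite /d [in LHS](fps_shiftE g) (lin _ _ _ S1 (SM SX Ss)) D1 scaler0 add0r.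
  by rewrite mul // linearD /= fps_derivC add0r fps_derivM fps_derivX mul1r; ring.
suff d0 n g : S g -> d g n = 0.
  move=> Sf; apply/eqP; rewrite -subr_eq0; apply/eqP/fpsP => n.
  by rewrite fps_coef0; apply: d0.
elim: n g => [|n IH] g Sg; rewrite dX // fps_coefXM //.
exact/IH/Sshift.
Qed.

Lemma x_ideal_sub k b : x_ideal S k b -> S b.
Proof. by move=> [r Sr ->]; apply: SM Sr; apply: shift_subalgXn. Qed.

Lemma x2DerP xi : x2Der S xi ->
  exists b, x_ideal S 2 b /\ forall f, S f -> xi f = fps_vf b f.
Proof.
move=> [a [D [[r Sr ->] DD xiE]]]; exists (fpsX ^+ 2 * r * D fpsX); split.
  by exists (r * D fpsX); rewrite ?mulrA //; apply: SM => //; case: DD => + _ _; apply.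
by move=> f Sf; rewrite xiE // (Der_deriv DD Sf) /fps_vf !mulrA.
Qed.

Lemma x2Der_Der xi : x2Der S xi -> Der S xi.
Proof.
move=> [a [D [[r Sr aE] [DS Dlin Dmul] xiE]]].
have Sa : S a by rewrite aE; apply: SM => //; apply: shift_subalgXn.
have SZ c f : S f -> S (c *: f) by rewrite -mulr_algl => Sf; apply: SM.
split=> [f Sf|c f g Sf Sg|f g Sf Sg].
- by rewrite xiE //; apply: SM => //; apply: DS.
- by rewrite !xiE ?Dlin //; [rewrite mulrDr scalerAr|apply: SD => //; apply: SZ].
- by rewrite !xiE ?Dmul //; [ring|apply: SM].
Qed.

Lemma iter_vf xi b j : Der S xi -> (forall f, S f -> xi f = fps_vf b f) ->
  S (iter j xi fpsX) /\ iter j xi fpsX = iter j (fps_vf b) fpsX.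
Proof.
move=> [xiS _ _] xiE; elim: j => //= j [Sj <-].
by split; [apply: xiS|apply: xiE].
Qed.

Lemma x_ideal2_ord b : x_ideal S 2 b -> order_ge 2 b.
Proof.
by move=> [r _ ->] [|[|i]] // _; rewrite exprS -mulrA fps_coefXM // expr1 fps_coefXM.
Qed.

Lemma x_ideal2P b : S b -> order_ge 2 b -> x_ideal S 2 b.
Proof.
move=> Sb b2; exists (fps_shift (fps_shift b)); first exact/Sshift/Sshift.
apply/fpsP => n; rewrite expr2 -mulrA fps_coefXM; case: n => [|n]; first exact: b2.
by rewrite fps_coefXM; case: n => [|n] //; apply: b2.
Qed.

Lemma x2Der_nilpotent xi : x2Der S xi -> x_nilpotent S xi.
Proof.
move=> xi2; have [xiS _ _] := x2Der_Der xi2.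
have {xi2} [a [D [[r Sr aE] [DS _ _] xiE]]] := xi2.
(* One application of [xi] already brings in the factor [fpsX ^+ 2]. *)
exists 1%N => -[//|N] _ f [g Sg fE].
have Sf : S f by rewrite fE expr1; apply: SM.
have SN : S (iter N xi f) by elim: N => //= N IH; apply: xiS.
exists (r * D (iter N xi f)); first by apply: SM => //; apply: DS.
by rewrite iterS xiE // aE mulrA.
Qed.

(** Each step lowers the order bound by one and multiplies the leading coefficient by [b(0)] times
    its exponent; after [j] steps the exponents have produced the factorial. *)
Lemma iter_vf_constant_term xi b j f :
  Der S xi -> (forall g, S g -> xi g = fps_vf b g) -> S f -> order_ge j f ->
  (iter j xi f) 0%N = b 0%N ^+ j * f j *+ j`!.
Proof.
move=> [xiS _ _] xiE; elim: j f => [|j IH] f Sf fj; first by rewrite mul1r.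
have E i : (i <= j)%N -> (xi f) i = b 0%N * f i.+1 *+ i.+1.
  move=> ij; rewrite xiE // /fps_vf fps_coefM big_ord_recl subn0 big1 ?addr0.
    by rewrite -mulrnAr.
  move=> k _; rewrite -[fps_deriv f _]/(f (i - k.+1).+1 *+ _) fj ?mul0rn ?mulr0 //.
  by rewrite ltnS (leq_trans _ ij) // ltn_subLR // ?addSn ?ltnS ?leq_addl // -ltnS.
rewrite iterSr IH; first by rewrite E // mulrnAr -mulrnA -factS mulrA -exprSr.
  exact: xiS.
by move=> i ij; rewrite E ?(ltnW ij) // fj ?mulr0 ?mul0rn.
Qed.

(** Once [b(0) = 0], constant terms stay zero and each step multiplies the linear coefficient by
    that of [b]. *)
Lemma iter_vf_linear_term xi b j :
  Der S xi -> (forall g, S g -> xi g = fps_vf b g) -> b 0%N = 0 ->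
  (iter j xi fpsX) 1%N = b 1%N ^+ j.
Proof.
move=> Dxi xiE b0.
suff : (iter j xi fpsX) 0%N = 0 /\ (iter j xi fpsX) 1%N = b 1%N ^+ j by case.
elim: j => [//|j [IH0 IH1]]; have [Sj _] := iter_vf j Dxi xiE.
rewrite iterS xiE // /fps_vf !fps_coefM big_ord1 b0 mul0r; split=> //.
by rewrite big_ord_recl big_ord1 b0 mul0r add0r subnn exprS /= IH1.
Qed.

Lemma nilpotent_ord xi b : (forall n, (n.+1%:R : K) \is a GRing.unit) ->
  Der S xi -> (forall f, S f -> xi f = fps_vf b f) -> x_nilpotent S xi -> order_ge 2 b.
Proof.
move=> natK Dxi xiE [N0 nil].
have b0 : b 0%N = 0.
  (* After [N0.+1] steps the constant term of this test series is [b(0) ^+ N0.+1] times a factorial,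
     and nilpotency kills it. The successor keeps the exponent positive even if [N0 = 0]. *)
  have H : x_ideal S 1 (fpsX ^+ N0.+1).
    by exists (fpsX ^+ N0); [exact: shift_subalgXn|rewrite expr1 exprS].
  have := x_ideal2_ord (nil N0.+1 (leqnSn _) _ H) (isT : 0 < 2)%N.
  rewrite (iter_vf_constant_term Dxi xiE) //; first last.
  - by move=> i iN; rewrite fps_coefXn ltn_eqF.
  - exact: shift_subalgXn.
  rewrite fps_coefXn eqxx mulr1 -mulr_natr -[RHS](mul0r (N0.+1`!%:R)).
  by move=> /(mulIr (natK_fact natK _))/eqP; rewrite expf_eq0 => /eqP.
(* The second test series is [x], whose linear coefficient after [N0.+1] steps is a power of
   [b 1]. *)
have H : x_ideal S 1 fpsX by exists 1; rewrite ?mulr1 ?expr1.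
have := x_ideal2_ord (nil N0.+1 (leqnSn _) _ H) (isT : 1 < 2)%N.
rewrite (iter_vf_linear_term _ Dxi xiE) // => /eqP; rewrite expf_eq0 => /eqP b1.
by move=> [|[|i]].
Qed.

End Derivations.

(** * Exponentials of derivations in the two rings *)

Fact tofrac_inj (A : idomainType) : injective (@tofrac A).
Proof. by move=> f g /eqP; rewrite tofrac_eq => /eqP. Qed.

Lemma diff_algebraic_exp (K : idomainType) (b : fps K) :
  (forall n, (n.+1%:R : K) \is a GRing.unit) ->
  x_ideal (@diff_algebraic K) 2 b -> diff_algebraic (fps_exp b fpsX).
Proof.
have R_subalg : shift_subalg (@diff_algebraic K) :=
  diff_algebraic_subalg (@tofrac_inj (fps K)).
move=> natK Rb; have b2 := x_ideal2_ord Rb.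
have [->|b0] := eqVneq b 0; first by rewrite fps_exp0; case: R_subalg.
have {}Rb := x_ideal_sub R_subalg Rb.
exact: (diff_algebraic_flow (@tofrac_inj _) (h := fps_exp_rmorph natK b2) (fps_expC b)
  b0 (fps_exp_flow natK b2) Rb).
Qed.

(** [xi] is known to agree with a vector field on [S] only, but the iterates starting from [fpsX]
    never leave [S]. *)
Lemma x2Der_exp (K : idomainType) (S : set (fps K)) (xi : fps K -> fps K) :
  shift_subalg S -> x2Der S xi ->
  exists b, x_ideal S 2 b /\ is_exp xi fpsX (fps_exp b fpsX).
Proof.
move=> SS xi2; have [b [Sb xiE]] := x2DerP SS xi2; exists b; split=> // n.
have [m0 H] := fps_exp_is_exp (x_ideal2_ord Sb) fpsX n.
exists m0 => m /H <-; congr (fps_coef _ n); apply: eq_bigr => j _.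
by have [_ ->] := iter_vf SS j (x2Der_Der SS xi2) xiE.
Qed.

Theorem corollary3p6 (K : idomainType) (iota : {rmorphism rat -> K})
    (K_local : local_ring K) :
  Der_exp (@diff_algebraic K) = x2Der (@diff_algebraic K)
  /\
  (* "Order 1" must be read as "order at most 1": xi = 0 and xi = x^2 d/dx give
     the algebraic series x and x/(1-x), of order 0. *)
  (forall xi : fps K -> fps K, x2Der (@algebraic_fps K) xi ->
     exists y : fps K,
       [/\ is_exp xi fpsX y,
           exists2 N : nat, diff_order y N & (N <= 1)%N
         & ~ algebraic_fps y -> diff_order y 1]).
Proof.
have natK n : (n.+1%:R : K) \is a GRing.unit.
  by rewrite -(rmorph_nat iota) rmorph_unit // unitfE Num.Theory.pnatr_eq0.
have R_subalg : shift_subalg (@diff_algebraic K) :=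
  diff_algebraic_subalg (@tofrac_inj (fps K)).
have A_subalg := algebraic_subalg (@tofrac_inj (fps K)).
split.
  apply/seteqP; split=> xi.
    move=> [Dxi nil _]; have [DR _ _] := Dxi.
    have Rc : diff_algebraic (xi fpsX) by apply: DR; case: R_subalg.
    have xiE f : diff_algebraic f -> xi f = fps_vf (xi fpsX) f.
      by move=> Rf; apply: (Der_deriv R_subalg Dxi Rf).
    (* [xi] is [xi(x) d/dx]; nilpotency puts [xi(x)] in [(x)^2], and [d/dx] preserves the ring. *)
    exists (xi fpsX), (@fps_deriv K); split=> //.
      by apply: (x_ideal2P R_subalg Rc); apply: (nilpotent_ord R_subalg natK Dxi xiE nil).
    split=> [f|c f g _ _|f g _ _]; first exact: (diff_algebraic_deriv (@tofrac_inj (fps K))).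
      exact: linearP.
    exact: fps_derivM.
  move=> xi2; have [b [Rb yE]] := x2Der_exp R_subalg xi2.
  split; [exact: x2Der_Der|exact: x2Der_nilpotent|].
  by exists (fps_exp b fpsX) => //; apply: diff_algebraic_exp natK Rb.
move=> xi xi2; have [b [Ab yE]] := x2Der_exp A_subalg xi2.
exists (fps_exp b fpsX).
have b2 := x_ideal2_ord Ab.
have {}Ab := x_ideal_sub A_subalg Ab.
have ode : solves_ode 1 (fps_exp b fpsX).
  (* For [b = 0] the exponential is [x], which is algebraic; otherwise the flow equation can be
     divided by [b]. *)
  have [->|b0] := eqVneq b 0.
    by rewrite fps_exp0; apply: (algebraic_ode1 (@tofrac_inj (fps K))); case: A_subalg.
  apply: (rmorph_flow_ode1 (@tofrac_inj (fps K)) (h := fps_exp_rmorph natK b2)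
    (fps_expC b) b0 Ab).
  by rewrite /= fps_exp_flow // fps_derivX -fps_expM // mulr1.
by have [] := diff_order_le1 ode.
Qed.
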